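(* The following conditions on $(s,n)\in\mathbb{C}\times\mathbb{Z}_{\ge0}$ are equivalent. (i) $\mathrm{Sol}_{\mathrm{II}}(s;n)\ne\{0\}$. (ii) One of the following holds: $n\equiv0\pmod4$ and $s\in\mathbb{C}$; $n\equiv1\pmod4$ and $s\in I_1$; $n\equiv2\pmod4$ and $s\in\mathbb{C}$; $n\equiv3\pmod4$ and $s\in I_3$. Further, for such $(s,n)$, the space $\mathrm{Sol}_{\mathrm{II}}(s;n)$ is given as follows. (1) $n\equiv0\pmod4$: $$\mathrm{Sol}_{\mathrm{II}}(s;n)=\begin{cases}\mathbb{C}a_{[s;n]}(t) & \text{if } s\in\mathbb{C}\setminus(I_0^+\cup I_0^-\cup J_0),\\ \mathbb{C}a_{[s;n]}(t)\oplus\mathbb{C}b_{[s;n]}(t) & \text{if } s\in I_0^+,\\ \mathbb{C}b_{[s;n]}(t) & \text{if } s\in J_0,\\ \mathbb{C}c^+_{[s;n]}(t)\oplus\mathbb{C}c^-_{[s;n]}(t) & \text{if } s\in I_0^-.\end{cases}$$ (2) $n\equiv1\pmod4$: $\mathrm{Sol}_{\mathrm{II}}(s;n)=\mathbb{C}a_{[s;n]}(t)\oplus\mathbb{C}b_{[s;n]}(t)$ for $s\in I_1$. (3) $n\equiv2\pmod4$: $$\mathrm{Sol}_{\mathrm{II}}(s;n)=\begin{cases}\mathbb{C}a_{[s;n]}(t) & \text{if } s\in\mathbb{C}\setminus(I_2^+\cup I_2^-\cup J_2),\\ \mathbb{C}a_{[s;n]}(t)\oplus\mathbb{C}b_{[s;n]}(t)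 & \text{if } s\in I_2^+,\\ \mathbb{C}b_{[s;n]}(t) & \text{if } s\in J_2,\\ \mathbb{C}c^+_{[s;n]}(t)\oplus\mathbb{C}c^-_{[s;n]}(t) & \text{if } s\in I_2^-.\end{cases}$$ (4) $n\equiv3\pmod4$: $\mathrm{Sol}_{\mathrm{II}}(s;n)=\mathbb{C}a_{[s;n]}(t)\oplus\mathbb{C}b_{[s;n]}(t)$ for $s\in I_3$.
   Context: $\mathrm{Pol}_n[t]$ is the space of complex polynomials in $t$ of degree at most $n$. $\mathrm{Sol}_{\mathrm{II}}(s;n)$ is the space of $p(t)\in\mathrm{Pol}_n[t]$ satisfying $$2(1-t^2)t\,p''(t)+\big((s+3n-3)t^2+(s-n+1)\big)p'(t)-n(s+n-1)t\,p(t)=0$$ (this is the equation $2\,d\pi_n^{\mathrm{II}}(D_s^\flat)p=0$, where $d\pi^{\mathrm{II}}_n(D_s^\flat)=\frac12 d\pi_n\big((E_++E_-)E_0-(s-1)(E_+-E_-)\big)$ with $d\pi_n(E_+)=-\frac{d}{dt}$, $d\pi_n(E_-)=-nt+t^2\frac{d}{dt}$, $d\pi_n(E_0)=-2t\frac{d}{dt}+n$). Sets (depending on $n$; $[\cdot]$ is the integer part): for $n\in4\mathbb{Z}_{\ge0}$, $I_0^\pm=\{\pm(3+4j):0\le j\le\frac n4-1\}$ and $J_0=\{1+4j:0\le j\le\frac n4-1\}$; and $I_1=\{\pm4j:0\le j\le[\frac n4]\}$, $I_2^\pm=\{\pm(1+4j):0\le j\le[\frac n4]\}$, $J_2=\{3+4j:0\le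 j\le[\frac n4]-1\}$, $I_3=\{\pm(2+4j):0\le j\le[\frac n4]\}$. Functions: with $F(a,b,c;z)={}_2F_1(a,b;c;z)$, $$a_{[s;n]}(t)=F\left(-\tfrac n2,-\tfrac{n+s-1}{4},\tfrac{3-n+s}{4};t^2\right),\qquad b_{[s;n]}(t)=t^{\frac{1+n-s}{2}}F\left(-\tfrac{n+s-1}{4},-\tfrac{s-1}{2},\tfrac{5+n-s}{4};t^2\right).$$ If the third parameter $c$ is a non-positive integer and one of the first two parameters is a non-positive integer $-N\ge c$ (with $N$ minimal among such), $F(a,b,c;z)$ is understood as the truncated sum $\sum_{j=0}^{N}\frac{(a,j)(b,j)}{(c,j)\,j!}z^j$ where $(\ell,m)=\Gamma(\ell+m)/\Gamma(\ell)=\ell(\ell+1)\cdots(\ell+m-1)$ is the shifted factorial; in particular $a_{[-1;4\ell+2]}(t)=\sum_{j=0}^{\ell}\frac{(-2\ell-1,j)}{j!}t^{2j}$. For $n\equiv k\pmod4$ with $k\in\{0,2\}$ and $s\in I_k^-$, $c^\pm_{[s;n]}(t)=a_{[s;n]}(t)\pm C(s;n)b_{[s;n]}(t)$, where $C(s;n)=\frac{(-\frac n2,[\frac n4])}{[\frac n4]!}$ if $n\equiv2\pmod4$ and $s=-1$, and otherwise $$C(s;n)=\frac{\left(-\frac n2,\frac{n+s-1}{4}\right)\left(-\frac{n+s-1}{4},\frac{n+s-1}{4}\right)}{\left(\frac{3-n+s}{4},\frac{n+s-1}{4}\right)}\cdot\frac{1}{\left(\frac{n+s-1}{4}\right)!}.$$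 *)

(* Defs.v *)
From mathcomp Require Import all_boot all_order all_algebra.
From mathcomp Require Import all_classical all_reals.
From mathcomp Require Export complex.

Set Implicit Arguments.
Unset Strict Implicit.
Unset Printing Implicit Defensive.

Import Order.TTheory GRing.Theory Num.Theory.

Local Open Scope classical_set_scope.
Local Open Scope ring_scope.

(* For R : realType, R[i] is the field of complex numbers. *)

(* Pol_n[t] is the condition [size p <= n.+1]; the unknown t is 'X. *)
Definition Sol_II (R : realType) (s : R[i]) (n : nat) : set {poly R[i]} :=
  [set p : {poly R[i]} | (size p <= n.+1)%N /\
     2%:P * (1 - 'X^2) * 'X * p^`(2)
     + ((s + 3 * n%:R - 3)%:P * 'X^2 + (s - n%:R + 1)%:P) * p^`()
     - (n%:R * (s + n%:R - 1))%:P * 'X * p = 0].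

(* Upper bounds [j <= k - 1] on an index are written [j < k], which also gives
   the empty set when k = 0. *)
Definition I0p (R : realType) (n : nat) : set R[i] :=
  [set s : R[i] | exists2 j : nat, (j < n %/ 4)%N & s = (3 + 4 * j)%:R].
Definition I0m (R : realType) (n : nat) : set R[i] :=
  [set s : R[i] | exists2 j : nat, (j < n %/ 4)%N & s = - (3 + 4 * j)%:R].
Definition J0 (R : realType) (n : nat) : set R[i] :=
  [set s : R[i] | exists2 j : nat, (j < n %/ 4)%N & s = (1 + 4 * j)%:R].
Definition I1 (R : realType) (n : nat) : set R[i] :=
  [set s : R[i] | exists2 j : nat, (j <= n %/ 4)%N &
     s = (4 * j)%:R \/ s = - (4 * j)%:R].
Definition I2p (R : realType) (n : nat) : set R[i] :=
  [set s : R[i] | exists2 j : nat, (j <= n %/ 4)%N & s = (1 + 4 * j)%:R].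
Definition I2m (R : realType) (n : nat) : set R[i] :=
  [set s : R[i] | exists2 j : nat, (j <= n %/ 4)%N & s = - (1 + 4 * j)%:R].
Definition J2 (R : realType) (n : nat) : set R[i] :=
  [set s : R[i] | exists2 j : nat, (j < n %/ 4)%N & s = (3 + 4 * j)%:R].
Definition I3 (R : realType) (n : nat) : set R[i] :=
  [set s : R[i] | exists2 j : nat, (j <= n %/ 4)%N &
     s = (2 + 4 * j)%:R \/ s = - (2 + 4 * j)%:R].

(* The shifted factorial (l, m) = l (l + 1) ... (l + m - 1). *)
Definition shifted_fact (R : realType) (l : R[i]) (m : nat) : R[i] :=
  \prod_(i < m) (l + i%:R).

Definition hyp2F1_coef (R : realType) (a b c : R[i]) (j : nat) : R[i] :=
  shifted_fact a j * shifted_fact b j / (shifted_fact c j * j`!%:R).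

(* [is_hyp2F1 a b c F]: the hypergeometric series F(a, b, c; z) is the
   polynomial F. If c is not a non-positive integer, the coefficients of F are
   those of the whole series. If c = - M, then F(a, b, c; z) only makes sense
   when a or b is - N for some N <= M, and it is then the sum truncated at the
   least such N. *)
Definition is_hyp2F1 (R : realType) (a b c : R[i]) (F : {poly R[i]}) : Prop :=
  ((forall M : nat, c <> - M%:R) /\
   (forall j : nat, F`_j = hyp2F1_coef a b c j))
  \/
  (exists M N : nat,
     [/\ c = - M%:R,
         (N <= M)%N,
         a = - N%:R \/ b = - N%:R,
         (forall N' : nat, a = - N'%:R \/ b = - N'%:R -> (N <= N')%N) &
         F = \sum_(j < N.+1) hyp2F1_coef a b c j *: 'X^j]).

(* The polynomial F(a, b, c; 'X), and 0 when F(a, b, c; z) is undefined or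
   not a polynomial. *)
Definition hyp2F1 (R : realType) (a b c : R[i]) : {poly R[i]} :=
  xget 0 [set F : {poly R[i]} | is_hyp2F1 a b c F].

(* The natural number equal to z, and 0 if there is none. *)
Definition nat_of_cplx (R : realType) (z : R[i]) : nat :=
  xget 0%N [set m : nat | m%:R = z].

Definition a_fun (R : realType) (s : R[i]) (n : nat) : {poly R[i]} :=
  hyp2F1 (- (n%:R / 2)) (- ((n%:R + s - 1) / 4)) ((3 - n%:R + s) / 4)
    \Po 'X^2.

(* Only used where (1 + n - s) / 2 is a natural number. *)
Definition b_fun (R : realType) (s : R[i]) (n : nat) : {poly R[i]} :=
  'X^(nat_of_cplx ((1 + n%:R - s) / 2)) *
  (hyp2F1 (- ((n%:R + s - 1) / 4)) (- ((s - 1) / 2)) ((5 + n%:R - s) / 4)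
    \Po 'X^2).

(* Only used where (n + s - 1) / 4 is a natural number. *)
Definition C_const (R : realType) (s : R[i]) (n : nat) : R[i] :=
  if (n %% 4 == 2)%N && (s == -1) then
    shifted_fact (- (n%:R / 2)) (n %/ 4) / (n %/ 4)`!%:R
  else
    let N := nat_of_cplx ((n%:R + s - 1) / 4) in
    shifted_fact (- (n%:R / 2)) N * shifted_fact (- ((n%:R + s - 1) / 4)) N
    / shifted_fact ((3 - n%:R + s) / 4) N * (1 / N`!%:R).

Definition c_plus (R : realType) (s : R[i]) (n : nat) : {poly R[i]} :=
  a_fun s n + C_const s n *: b_fun s n.
Definition c_minus (R : realType) (s : R[i]) (n : nat) : {poly R[i]} :=
  a_fun s n - C_const s n *: b_fun s n.

Definition line (R : realType) (f : {poly R[i]}) : set {poly R[i]} :=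
  [set p : {poly R[i]} | exists x : R[i], p = x *: f].

(* V is the direct sum of the lines spanned by f and g, both nonzero. *)
Definition is_direct_sum (R : realType) (V : set {poly R[i]})
    (f g : {poly R[i]}) : Prop :=
  V = [set p : {poly R[i]} | exists x y : R[i], p = x *: f + y *: g] /\
  (forall x y : R[i], x *: f + y *: g = 0 -> x = 0 /\ y = 0).

(* Main.v *)
Require Import Defs.
From mathcomp Require Import all_boot all_order all_algebra.
From mathcomp Require Import all_classical all_reals.
From mathcomp Require Import zify ring.
Set Implicit Arguments.
Unset Strict Implicit.
Unset Printing Implicit Defensive.
Import Order.TTheory GRing.Theory Num.Theory.
Local Open Scope classical_set_scope.
Local Open Scope ring_scope.

(** Read on the coefficients of [p], the differential equation is the two-step
    recurrence

      (k+2) (2 (k+2) - (n+1-s)) p_{k+2} = (2 k - (n+s-1)) (k - n) p_k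

    with initial condition (2 - (n+1-s)) p_1 = 0 ([Sol_IIP]).  So the even and
    the odd coefficients evolve independently, and everything is decided by the
    zeros of the two factors.

    Starting a chain.  The factor on the left vanishes only at the exponent
    k0 = (n+1-s)/2, when that is a positive integer.  Together with 0 it is the
    other exponent of the equation at t = 0, and a solution is determined by
    its coefficients p_0 and p_{k0} ([Sol_II_eq0]).  In particular the
    dimension is at most 2.

    Ending a chain.  Since deg p <= n, a chain that is nonzero at k has to be
    stopped by a zero of the factor on the right: it stops at n or at
    (n+s-1)/2 = n - k0, and before that it cannot cross k0, where the recurrence
    forces a zero ([Sol_II_last_exponent]).

    The hypergeometric functions are exactly the chains starting at 0 (for
    [a_fun], see [a_fun_Sol]) and at k0 (for [b_fun], see [b_fun_Sol]).

    Everything then depends on the parities of n and k0 and on the position of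
    k0 with respect to n/2.  For n even:
    - k0 odd and k0 <= n/2: both chains exist, the second one running from k0 to
      n - k0;
    - k0 even and 0 < k0 <= n/2: the chain from 0 hits the obstruction at k0, so
      only the chain from k0 survives;
    - k0 even and n/2 < k0 <= n: the chain from 0 stops at n - k0, before
      reaching k0, and both exist; as [C_const] is not zero, [c_plus] and
      [c_minus] span the same plane;
    - otherwise the chain from 0 alone.
    For n odd, the chain from 0 cannot stop at n, so it needs n - k0 even and
    between 0 and n, and the chain from k0 needs k0 odd and at most n: the two
    conditions coincide, and the dimension is 2 or 0.

    Solving s = n + 1 - 2 k0 for k0 turns the sets [I0p], ..., [I3] into these
    conditions on k0 ([I0pP], ..., [I3P]).  Below, k0 is introduced by the
    equation [(2 * k)%:R = n.+1%:R - s]. *)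

Section Solutions.
Variable R : realType.
Implicit Types (s a b c l x y : R[i]) (p q f g F : {poly R[i]}).
Implicit Types (n k m i j D N : nat).

(** * The recurrence on coefficients *)

(** The operator sends t^k to a combination of t^(k-1) and t^(k+1), whence a
    two-step recurrence.  The coefficient of t^(k+1), quadratic in k, factors as
    - (2 k - (n + s - 1)) (k - n). *)
Lemma Sol_IIP s n p : Sol_II s n p <->
  [/\ (size p <= n.+1)%N, (2 - (n.+1%:R - s)) * p`_1 = 0 &
      forall k, (k.+2)%:R * ((2 * k.+2)%:R - (n.+1%:R - s)) * p`_k.+2
                = ((2 * k)%:R - (n%:R + s - 1)) * (k%:R - n%:R) * p`_k].
Proof.
rewrite /Sol_II /=.
set L := (X in (X = 0)).
have L0 : L`_0 = (2 - (n.+1%:R - s)) * p`_1.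
  have -> : L = (s - n%:R + 1)%:P * p^`()
      + 'X * (2%:P * ((1 - 'X^2) * p^`(2))
              + (s + 3 * n%:R - 3)%:P * ('X * p^`())
              - (n%:R * (s + n%:R - 1))%:P * p).
    by rewrite /L; ring.
  rewrite coefD coefXM addr0 coefCM coef_deriv; ring.
have LS k : L`_k.+1 =
    k.+2%:R * ((2 * k.+2)%:R - (n.+1%:R - s)) * p`_k.+2
    - ((2 * k)%:R - (n%:R + s - 1)) * (k%:R - n%:R) * p`_k.
  have -> : L = (s - n%:R + 1)%:P * p^`()
      + 'X * (2%:P * p^`(2) - 2%:P * ('X^2 * p^`(2))
              + (s + 3 * n%:R - 3)%:P * ('X * p^`())
              - (n%:R * (s + n%:R - 1))%:P * p).
    by rewrite /L; ring.
  rewrite coefD coefXM coefCM coefB coefD coefB !coefCM coefXnM coefXM.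
  rewrite !(coef_deriv, derivnS, derivn0).
  case: k => [|[|k]] /=;
    rewrite ?subn0 ?subSS ?subn0 ?(coef_deriv, derivnS, derivn0) /=;
    rewrite ?mul0r ?mulr0 ?subn1 /=; ring.
split=> [[sz L_eq0]|[sz e0 eS]].
  split=> //; first by rewrite -L0 L_eq0 coef0.
  by move=> k; apply/eqP; rewrite -subr_eq0 -LS L_eq0 coef0.
split=> //; apply/polyP => -[|k]; rewrite coef0; first by rewrite L0 e0.
by rewrite LS eS subrr.
Qed.

Lemma Sol_II_lin s n x y p q :
  Sol_II s n p -> Sol_II s n q -> Sol_II s n (x *: p + y *: q).
Proof.
move=> /Sol_IIP[szp p1 pS] /Sol_IIP[szq q1 qS]; apply/Sol_IIP; split.
- rewrite (leq_trans (size_polyD _ _)) // geq_max.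
  by rewrite !(leq_trans (size_scale_leq _ _)).
- by rewrite coefD !coefZ mulrDr !(mulrCA (_ - _)) p1 q1 !mulr0 addr0.
- move=> k; rewrite !coefD !coefZ mulrDr mulrCA pS [_ * (y * _)]mulrCA qS.
  by ring.
Qed.

Lemma Sol_IIB s n p q : Sol_II s n p -> Sol_II s n q -> Sol_II s n (p - q).
Proof.
by move=> Sp Sq; rewrite -[p]scale1r -[- q]scaleN1r; apply: Sol_II_lin.
Qed.

Lemma Sol_II0 s n : Sol_II s n 0.
Proof.
apply/Sol_IIP; rewrite size_poly0 coef0 mulr0; split=> // k.
by rewrite !coef0 !mulr0.
Qed.

Lemma Sol_IIZ s n x p : Sol_II s n p -> Sol_II s n (x *: p).
Proof.
by move=> Sp; rewrite -[x *: p]addr0 -(scale0r p); apply: Sol_II_lin.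
Qed.

(** The factor in front of p_k in the recurrence is nonzero unless k is an
    exponent of the equation at t = 0, that is, 0 or (n + 1 - s)/2; hence a
    solution vanishing there vanishes. *)
Lemma Sol_II_eq0 s n p : Sol_II s n p -> p`_0 = 0 ->
  (forall k, (0 < k)%N -> (2 * k)%:R = n.+1%:R - s -> p`_k = 0) -> p = 0.
Proof.
move=> /Sol_IIP[_ p1 pS] p0 p_free; apply/polyP => k; rewrite coef0.
elim/ltn_ind: k => -[|[|k]] IHk //.
- have [e1|e1] := eqVneq (2 - (n.+1%:R - s)) 0.
    by apply: p_free => //; apply/eqP; rewrite muln1 -subr_eq0 e1.
  by move/eqP: p1; rewrite mulf_eq0 (negPf e1) => /eqP.
- have := pS k; rewrite (IHk k) // mulr0 => /eqP.
  have [e1 _|e1] := eqVneq ((2 * k.+2)%:R - (n.+1%:R - s)) 0.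
    by apply: p_free => //; apply/eqP; rewrite -subr_eq0 e1.
  by rewrite !mulf_eq0 (negPf e1) pnatr_eq0 => /eqP.
Qed.

(** Climb from k by steps of two as long as the right-hand factors of the
    recurrence are nonzero.  Each step finds a nonzero coefficient and a nonzero
    left-hand factor, and the climb stops because the degree is bounded. *)
Lemma Sol_II_last_exponent s n p k : Sol_II s n p -> p`_k != 0 ->
  exists i, [/\ (k + 2 * i <= n)%N,
     (k + 2 * i)%N = n \/ (2 * (k + 2 * i))%:R = n%:R + s - 1 &
     forall j, (0 < j <= i)%N -> (2 * (k + 2 * j))%:R <> n.+1%:R - s].
Proof.
move=> /Sol_IIP[szp _ pS].
have le_n j : p`_j != 0 -> (j <= n)%N.
  move=> pj; rewrite -ltnS (leq_trans _ szp) // ltnNge.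
  by apply: contra pj => /leq_sizeP->.
have [m] := ubnP (n - k); elim: m k => // m IHm k lt_m pk.
have [->|k_neq_n] := eqVneq k n.
  by exists 0%N; rewrite addn0; split=> //; [left|move=> [|j]].
have [e|k_neq] := eqVneq ((2 * k)%:R) (n%:R + s - 1).
  by exists 0%N; rewrite addn0; split=> //; [exact: le_n|right|move=> [|j]].
have: ((2 * k)%:R - (n%:R + s - 1)) * (k%:R - n%:R) * p`_k != 0.
  by rewrite !mulf_neq0 // subr_eq0 // eqr_nat.
rewrite -pS !mulf_eq0 !negb_or subr_eq0 => /andP[/andP[_ fk] pk2].
have := le_n _ pk2 => le_k2.
have [|i [lei endi freei]] := IHm k.+2 _ pk2; first by lia.
exists i.+1; have -> : (k + 2 * i.+1 = k.+2 + 2 * i)%N by lia.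
split=> // -[|[|j]] // ltj; first by apply/eqP; rewrite muln1 addn2.
by have := freei j.+1 ltj; congr (_%:R <> _); lia.
Qed.

(** * Hypergeometric polynomials *)

Lemma shifted_fact0 l : shifted_fact l 0 = 1.
Proof. by rewrite /shifted_fact big_ord0. Qed.

Lemma shifted_factS l m :
  shifted_fact l m.+1 = shifted_fact l m * (l + m%:R).
Proof. by rewrite /shifted_fact big_ord_recr. Qed.

Lemma shifted_fact_eq0 N m : (N < m)%N -> shifted_fact (- N%:R : R[i]) m = 0.
Proof.
move=> ltNm; rewrite /shifted_fact (bigD1 (Ordinal ltNm)) //=.
by rewrite addNr mul0r.
Qed.

Lemma shifted_fact_neq0 l m :
  (forall i, (i < m)%N -> l <> - i%:R) -> shifted_fact l m != 0.
Proof.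
move=> l_neq; apply/prodf_neq0 => i _; rewrite addr_eq0.
by apply/eqP; apply: l_neq.
Qed.

(** Both readings of F(a, b, c; z), the full series and the truncated sum, cut
    the series at the least N with a = - N or b = - N: in the first case all
    later terms vanish.  The bound on c says that no denominator vanishes up to
    the degree D, so one polynomial recurrence covers the two readings. *)
Lemma hyp2F1_spec a b c D (F := hyp2F1 a b c) :
    a = - D%:R \/ b = - D%:R ->
    (forall M, (M < D)%N -> c <> - M%:R) ->
  [/\ (size F <= D.+1)%N, F`_0 = 1 &
      forall j, j.+1%:R * (c + j%:R) * F`_j.+1
                = (a + j%:R) * (b + j%:R) * F`_j].
Proof.
move=> abD cD.
have exN : exists N, (a == - N%:R) || (b == - N%:R).
  by exists D; case: abD => ->; rewrite eqxx ?orbT.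
have [N abN minN] := ex_minnP exN.
have leND : (N <= D)%N by apply: minN; case: abD => ->; rewrite eqxx ?orbT.
have coef_gtN j : (N < j)%N -> hyp2F1_coef a b c j = 0.
  move=> ltNj; rewrite /hyp2F1_coef.
  by case/orP: abN => /eqP->; rewrite shifted_fact_eq0 ?mul0r ?mulr0 ?mul0r.
have -> : F = \poly_(j < N.+1) hyp2F1_coef a b c j.
  apply: xget_unique.
    have [[M cM]|c_neq] := pselect (exists M, c = - M%:R); last first.
      left; split=> [M cM|j]; first by apply: c_neq; exists M.
      rewrite coef_poly; case: ifPn => //; rewrite -leqNgt => /coef_gtN //.
    right; exists M, N; split=> //; last by rewrite poly_def.
    - rewrite (leq_trans leND) // leqNgt; apply/negP => /cD; exact.
    - by case/orP: abN => /eqP->; [left|right].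
    - by move=> N' abN'; apply: minN; case: abN' => ->; rewrite eqxx ?orbT.
  move=> G [[c_neq GE]|[M [N' [cM leN'M abN' minN' ->]]]].
    apply/polyP => j; rewrite GE coef_poly; case: ifPn => //.
    by rewrite -leqNgt => /coef_gtN.
  have -> : N' = N; last by rewrite poly_def.
  apply/eqP; rewrite eqn_leq minN' /=; last first.
    by case/orP: abN => /eqP->; [left|right].
  by apply: minN; case: abN' => ->; rewrite eqxx ?orbT.
split; first by rewrite (leq_trans (size_poly _ _)).
  by rewrite coef_poly /= /hyp2F1_coef !shifted_fact0 fact0 !mul1r invr1.
move=> j; rewrite !coef_poly !ltnS; have [ltjN|ltNj|->] := ltngtP j N.
- have cj : c + j%:R != 0.
    by rewrite addr_eq0; apply/eqP/cD/(leq_trans ltjN).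
  have sfc : shifted_fact c j != 0.
    by apply: shifted_fact_neq0 => i ltij; apply: cD; lia.
  rewrite /hyp2F1_coef !shifted_factS factS natrM.
  have fj : j`!%:R != 0 :> R[i] by rewrite pnatr_eq0 -lt0n fact_gt0.
  have j1 : j.+1%:R != 0 :> R[i] by rewrite pnatr_eq0.
  by field; rewrite fj sfc cj nat1r j1.
- by rewrite !mulr0.
- by case/orP: abN => /eqP->; rewrite addNr ?mul0r ?mulr0 ?mul0r.
Qed.

(** * The chains starting at the exponents 0 and (n + 1 - s)/2 *)

Lemma even_or_odd k : exists j, k = (2 * j)%N \/ k = (2 * j).+1.
Proof.
exists (k %/ 2)%N; lia.
Qed.

(** The even coefficients of a solution satisfy, up to the factor 8, the
    hypergeometric recurrence of [a_fun].  The integer D bounds the length of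
    the sum: either n/2 or (n + s - 1)/4 can terminate it; the last hypothesis
    keeps the second exponent (n + 1 - s)/2 out of the range 2, ..., 2 D. *)
Lemma a_fun_Sol s n D : (2 * D <= n)%N ->
    n = (2 * D)%N \/ n%:R + s - 1 = (4 * D)%:R ->
    (forall M, (M < D)%N -> (2 * (2 * M.+1))%:R <> n.+1%:R - s) ->
  Sol_II s n (a_fun s n) /\ (a_fun s n)`_0 = 1.
Proof.
move=> leDn nD cD; rewrite /a_fun.
have [||] := @hyp2F1_spec (- (n%:R / 2)) (- ((n%:R + s - 1) / 4))
   ((3 - n%:R + s) / 4) D.
- case: nD => [->|->]; [left|right]; congr (- _); by rewrite natrM; field.
- move=> M ltMD e; apply: (cD M ltMD).
  have -> : s = 4 * ((3 - n%:R + s) / 4) + n%:R - 3 by field.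
  by rewrite e; ring.
set F := hyp2F1 _ _ _ => szF F0 FS.
have F2 j : (F \Po 'X^2)`_(2 * j) = F`_j.
  by rewrite coef_comp_poly_Xn // dvdn_mulr // mulKn.
have F2S j : (F \Po 'X^2)`_(2 * j).+1 = 0.
  by rewrite coef_comp_poly_Xn // ifF //; lia.
split; last by rewrite (F2 0%N).
apply/Sol_IIP; split.
- apply/leq_sizeP => k ltnk.
  have [j [kE|kE]] := even_or_odd k.
    rewrite kE F2; apply: (leq_sizeP _ _ szF); lia.
  by rewrite kE F2S.
- by rewrite -[1%N]/(2 * 0).+1 F2S mulr0.
- move=> k.
  have [j [->|->]] := even_or_odd k.
    have -> : (2 * j).+2 = (2 * j.+1)%N by lia.
    rewrite !F2.
    transitivity (8 * (j.+1%:R * ((3 - n%:R + s) / 4 + j%:R) * F`_j.+1)).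
      by field.
    by rewrite FS; field.
  have -> : (2 * j).+3 = (2 * j.+1).+1%N by lia.
  by rewrite !F2S !mulr0.
Qed.

(** With k = (n + 1 - s)/2, the third parameter of [b_fun] is 1 + k/2 > 0, so
    its series always makes sense. *)
Lemma b_fun_Sol s n k D : (0 < k)%N -> (2 * k)%:R = n.+1%:R - s ->
    (k + 2 * D <= n)%N ->
    n%:R + s - 1 = (4 * D)%:R \/ s - 1 = (2 * D)%:R ->
  [/\ Sol_II s n (b_fun s n), (b_fun s n)`_0 = 0 & (b_fun s n)`_k = 1].
Proof.
move=> k_gt0 kE leDn sD; rewrite /b_fun.
have sE : s = n.+1%:R - (2 * k)%:R by rewrite kE; ring.
have -> : nat_of_cplx ((1 + n%:R - s) / 2) = k.
  apply: xget_unique => [/=|j /= jE]; first by rewrite sE; field.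
  by apply/eqP; rewrite -(eqr_nat R[i]) jE sE; apply/eqP; field.
have [||] := @hyp2F1_spec (- ((n%:R + s - 1) / 4)) (- ((s - 1) / 2))
   ((5 + n%:R - s) / 4) D.
- case: sD => ->; [left|right]; congr (- _); by rewrite natrM; field.
- move=> M _ e.
  have: (4 + 2 * k + 4 * M)%:R = 0 :> R[i].
    transitivity (4 * ((5 + n%:R - s) / 4 + M%:R)); first by rewrite sE; field.
    by rewrite e addNr mulr0.
  by move/eqP; rewrite pnatr_eq0.
set F := hyp2F1 _ _ _ => szF F0 FS.
set G := 'X^k * _.
have G0 j : (j < k)%N -> G`_j = 0 by move=> ltjk; rewrite coefXnM ltjk.
have G2 j : G`_(k + 2 * j) = F`_j.
  rewrite coefXnM ifF; last lia.
  by rewrite addKn coef_comp_poly_Xn // dvdn_mulr // mulKn.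
have G2S j : G`_(k + 2 * j).+1 = 0.
  rewrite coefXnM ifF; last lia.
  by rewrite coef_comp_poly_Xn // ifF //; lia.
have caseE j : (k <= j)%N -> exists i, j = (k + 2 * i)%N \/ j = (k + 2 * i).+1.
  move=> lekj; have [i iE] := even_or_odd (j - k); exists i; lia.
split; [|exact: G0|by have := G2 0%N; rewrite addn0 F0].
apply/Sol_IIP; split.
- apply/leq_sizeP => j ltnj.
  have [|i [jE|jE]] := caseE j; [lia| |by rewrite jE G2S].
  rewrite jE G2; apply: (leq_sizeP _ _ szF); lia.
(* The coefficient at 1 is nonzero only if k = 1, and then the factor is 0. *)
- case: k k_gt0 kE {sE leDn} @G G0 G2 G2S caseE => // -[|k] _ <- G G0 _ _ _.
    by rewrite muln1 subrr mul0r.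
  by rewrite G0 ?mulr0.
- move=> j; have [lekj|ltjk] := leqP k j.
    have [i [->|->]] := caseE j lekj.
      have -> : (k + 2 * i).+2 = (k + 2 * i.+1)%N by lia.
      rewrite !G2.
      transitivity (8 * ((k + 2 * i.+1)%:R / 2 * i.+1%:R * F`_i.+1)).
        rewrite sE; by field.
      transitivity (8 * (i.+1%:R * ((5 + n%:R - s) / 4 + i%:R) * F`_i.+1)).
        by rewrite sE; field.
      by rewrite FS sE; field.
    have -> : (k + 2 * i).+3 = (k + 2 * i.+1).+1 by lia.
    by rewrite !G2S !mulr0.
  rewrite (G0 j) // mulr0 -kE.
  have [ltj2k|] := ltnP j.+2 k; first by rewrite G0 ?mulr0.
  rewrite leq_eqVlt => /predU1P[->|ltkj2]; first by rewrite subrr mulr0 mul0r.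
  have -> : j.+2 = (k + 2 * 0).+1 by lia.
  by rewrite G2S mulr0.
Qed.

(** With 4 N = n + s - 1, the factors of the shifted factorials in [C_const]
    vanish at the indices n/2, N and n/2 - 1 - N.  The bound 4 N < n puts those
    of them that are integers at N or above, outside the products. *)
Lemma C_const_neq0 s n N :
  n%:R + s - 1 = (4 * N)%:R -> (4 * N < n)%N -> C_const s n != 0.
Proof.
move=> NE lt_N_n; have a_neq0 m :
    (2 * m <= n)%N -> shifted_fact (- (n%:R / 2) : R[i]) m != 0.
  move=> le_m; apply: shifted_fact_neq0 => i lt_i /oppr_inj ni.
  have /eqP : n%:R = (2 * i)%:R :> R[i] by rewrite natrM -ni; field.
  rewrite eqr_nat; lia.
have fact_neq0 m : m`!%:R != 0 :> R[i] by rewrite pnatr_eq0 -lt0n fact_gt0.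
rewrite /C_const; case: ifP => _.
  by rewrite mulf_neq0 ?invr_neq0 // a_neq0 //; lia.
have -> : nat_of_cplx ((n%:R + s - 1) / 4) = N.
  apply: xget_unique => [/=|j /= jE]; first by rewrite NE natrM; field.
  by apply/eqP; rewrite -(eqr_nat R[i]) jE NE natrM; apply/eqP; field.
rewrite !mulf_neq0 ?invr_neq0 ?oner_neq0 //.
- by apply: a_neq0; lia.
- apply: shifted_fact_neq0 => i lt_i /oppr_inj.
  rewrite NE natrM mulrAC divff ?pnatr_eq0 // mul1r.
  by move/eqP; rewrite eqr_nat; lia.
- apply: shifted_fact_neq0 => i lt_i iE.
  have /eqP : (4 * (N + i + 1))%:R = (2 * n)%:R :> R[i].
    transitivity ((4 * N)%:R + 4 - 4 * - i%:R : R[i]); first by ring.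
    by rewrite -iE -NE; field.
  rewrite eqr_nat; lia.
Qed.

(** * Bases of the solution space from coefficients at the exponents *)

Lemma exponent_inj s n k k' :
  (2 * k)%:R = n.+1%:R - s -> (2 * k')%:R = n.+1%:R - s -> k = k'.
Proof.
move=> <- /eqP; rewrite eqr_nat; lia.
Qed.

(** [f] and [g] are dual to the exponents 0 and k up to a triangular change of
    basis, and a solution is determined by its coefficients there. *)
Lemma Sol_II_direct_sum s n k f g : (0 < k)%N -> (2 * k)%:R = n.+1%:R - s ->
    Sol_II s n f -> f`_0 = 1 -> [/\ Sol_II s n g, g`_0 = 0 & g`_k = 1] ->
  is_direct_sum (Sol_II s n) f g.
Proof.
move=> k_gt0 kE Sf f0 [Sg g0 gk]; split.
  apply/seteqP; split=> p /= => [Sp|[x [y ->]]]; last exact: Sol_II_lin.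
  exists p`_0, (p`_k - p`_0 * f`_k).
  apply/subr0_eq/(@Sol_II_eq0 s n).
  - by apply: Sol_IIB => //; apply: Sol_II_lin.
  - by rewrite coefB coefD !coefZ f0 g0; ring.
  - by move=> k' _ /(exponent_inj kE) <-; rewrite coefB coefD !coefZ gk; ring.
move=> x y xy0.
have x0 : x = 0.
  move/(congr1 (fun p => p`_0)): xy0.
  by rewrite coefD !coefZ f0 g0 mulr1 mulr0 addr0 coef0.
split=> //; move/(congr1 (fun p => p`_k)): xy0.
by rewrite x0 coefD !coefZ gk mulr1 mul0r add0r coef0.
Qed.

Lemma direct_sum_add_sub (V : set {poly R[i]}) f g x : x != 0 ->
  is_direct_sum V f g -> is_direct_sum V (f + x *: g) (f - x *: g).
Proof.
move=> x0 [-> fg0]; split.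
  apply/seteqP; split=> p /= [y [z ->]].
    exists ((y + z / x) / 2), ((y - z / x) / 2).
    rewrite !scalerDr !scalerN !scalerA addrACA -scalerDl -scalerBl.
    by congr (_ *: _ + _ *: _); field.
  exists (y + z), ((y - z) * x).
  by rewrite !scalerDr !scalerN !scalerA addrACA -scalerDl -scalerBl mulrBl.
move=> y z; rewrite !scalerDr !scalerN !scalerA addrACA.
rewrite -scalerDl -scalerBl -mulrBl.
move=> /fg0[yz0 /eqP]; rewrite mulf_eq0 (negPf x0) orbF subr_eq0 => /eqP yz.
move: yz0; rewrite yz -mulr2n => /eqP; rewrite mulrn_eq0 /= => /eqP z0.
by rewrite z0.
Qed.

Lemma Sol_II_line s n k f : Sol_II s n f -> f`_k = 1 ->
  (forall p, Sol_II s n p -> p`_k = 0 -> p = 0) -> Sol_II s n = line f.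
Proof.
move=> Sf fk inj; apply/seteqP; split=> p /= => [Sp|[x ->]].
  exists p`_k; apply/subr0_eq/inj.
    by apply: Sol_IIB => //; apply: Sol_IIZ.
  by rewrite coefB coefZ fk mulr1 subrr.
exact: Sol_IIZ.
Qed.

(** * The solution space by parity and position of the second exponent *)

(** Neither chain meets the other, by parity: the chain from 0 stops at n, and
    the one from k at n - k, which is at least k. *)
Lemma Sol_II_even_odd_exponent s n k : ~~ odd n -> odd k -> (2 * k <= n)%N ->
    (2 * k)%:R = n.+1%:R - s ->
  is_direct_sum (Sol_II s n) (a_fun s n) (b_fun s n).
Proof.
move=> n_even k_odd le_k kE.
have [||M _|Sa a0] := @a_fun_Sol s n n./2; [lia|left; lia| |].
  by rewrite -kE => /eqP; rewrite eqr_nat; lia.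
apply: (Sol_II_direct_sum _ kE Sa a0); first lia.
apply: (@b_fun_Sol s n k (n./2 - k)) => //; [lia|lia|right].
have -> : s = n.+1%:R - (2 * k)%:R by rewrite kE; ring.
rewrite {1}(_ : n = 2 * (n./2 - k) + 2 * k)%N; [ring|lia].
Qed.

(** A chain from 0 would stop at n - k or n, both at least k, after
    crossing the obstruction at k; so there is none. *)
Lemma Sol_II_even_small_exponent s n k : ~~ odd n -> ~~ odd k -> (0 < k)%N ->
    (2 * k <= n)%N -> (2 * k)%:R = n.+1%:R - s ->
  Sol_II s n = line (b_fun s n).
Proof.
move=> n_even k_even k_gt0 le_k kE.
have sE : s = n.+1%:R - (2 * k)%:R by rewrite kE; ring.
have [||Sb b0 bk] := @b_fun_Sol s n k (n./2 - k) k_gt0 kE; [lia|right| ].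
  rewrite sE {1}(_ : n = 2 * (n./2 - k) + 2 * k)%N; [ring|lia].
apply: (Sol_II_line Sb bk) => p Sp pk; apply: (Sol_II_eq0 Sp); last first.
  by move=> k' _ /(exponent_inj kE) <-.
apply/eqP/negPn/negP => p0.
have [i [le_i end_i free_i]] := Sol_II_last_exponent Sp p0.
have le_k_i : (k <= 2 * i)%N.
  case: end_i => [|iE]; first lia.
  have /eqP : (2 * (2 * i) + 2 * k)%:R = (2 * n)%:R :> R[i].
    by rewrite natrD iE sE; ring.
  rewrite eqr_nat; lia.
apply: (free_i k./2); first lia.
by rewrite -kE; congr (_ _); lia.
Qed.

(** The chain from 0 stops at n - k < k, below the obstruction; the one from k
    stops at n.  When s = -1 and n = 2 modulo 4, n - k = k - 2 and both factors
    of the recurrence vanish at the step between them. *)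
Lemma Sol_II_even_large_exponent s n k : ~~ odd n -> ~~ odd k ->
    (n < 2 * k)%N -> (k <= n)%N -> (2 * k)%:R = n.+1%:R - s ->
  is_direct_sum (Sol_II s n) (c_plus s n) (c_minus s n).
Proof.
move=> n_even k_even lt_k le_k kE.
have sE : s = n.+1%:R - (2 * k)%:R by rewrite kE; ring.
have NE : n%:R + s - 1 = (4 * (n - k)./2)%:R.
  rewrite (_ : 4 * (n - k)./2 = 2 * (n - k))%N; last lia.
  by rewrite natrM natrB // sE; ring.
apply: direct_sum_add_sub; first by apply: (C_const_neq0 NE); lia.
have [||M lt_M|Sa a0] := @a_fun_Sol s n (n - k)./2; [lia|by right| |].
  by rewrite -kE => /eqP; rewrite eqr_nat; lia.
apply: (Sol_II_direct_sum _ kE Sa a0); first lia.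
by apply: (@b_fun_Sol s n k (n - k)./2) => //; [lia|lia|left].
Qed.

Lemma Sol_II_even_generic s n : ~~ odd n ->
    (forall k, ~~ odd k -> (0 < k <= n)%N -> (2 * k)%:R <> n.+1%:R - s) ->
  Sol_II s n (a_fun s n) /\ (a_fun s n)`_0 = 1.
Proof.
move=> n_even s_neq; apply: (@a_fun_Sol s n n./2); [lia|left; lia|].
by move=> M lt_M; apply: s_neq; lia.
Qed.

(** A chain starting at an odd k cannot stop at n, so it stops at n - k, which
    forces 2 k <= n. *)
Lemma Sol_II_even_line s n : ~~ odd n ->
    (forall k, ~~ odd k -> (0 < k <= n)%N -> (2 * k)%:R <> n.+1%:R - s) ->
    (forall k, odd k -> (2 * k <= n)%N -> (2 * k)%:R <> n.+1%:R - s) ->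
  Sol_II s n = line (a_fun s n).
Proof.
move=> n_even s_neq_even s_neq_odd.
have [Sa a0] := Sol_II_even_generic n_even s_neq_even.
apply: (Sol_II_line Sa a0) => p Sp p0; apply: (Sol_II_eq0 Sp) => // k k_gt0 kE.
apply/eqP/negPn/negP => pk.
have [i [le_i end_i _]] := Sol_II_last_exponent Sp pk.
have [k_odd|k_even] := boolP (odd k); last by apply: (s_neq_even k) => //; lia.
apply: (s_neq_odd k) => //.
case: end_i => [|iE]; first lia.
have /eqP : (2 * (k + 2 * i) + 2 * k)%:R = (2 * n)%:R :> R[i].
  by rewrite natrD iE kE; ring.
rewrite eqr_nat; lia.
Qed.

(** The residues 0 and 2 modulo 4 differ only in how the sets of values of s are
    listed; in terms of the second exponent they are treated together. *)
Lemma Sol_II_even_cases s n (Ip Im J : Prop) : ~~ odd n ->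
    (Ip <-> exists k, [/\ odd k, (2 * k <= n)%N & (2 * k)%:R = n.+1%:R - s]) ->
    (Im <-> exists k, [/\ ~~ odd k, (n < 2 * k)%N, (k <= n)%N &
                          (2 * k)%:R = n.+1%:R - s]) ->
    (J <-> exists k, [/\ ~~ odd k, (0 < k)%N, (2 * k <= n)%N &
                         (2 * k)%:R = n.+1%:R - s]) ->
  [/\ ~ ((Ip \/ Im) \/ J) -> Sol_II s n = line (a_fun s n),
      Ip -> is_direct_sum (Sol_II s n) (a_fun s n) (b_fun s n),
      J -> Sol_II s n = line (b_fun s n) &
      Im -> is_direct_sum (Sol_II s n) (c_plus s n) (c_minus s n)].
Proof.
move=> n_even IpP ImP JP; split=> [nIJ|/IpP[k [k_odd le_k kE]]|
  /JP[k [k_even k_gt0 le_k kE]]|/ImP[k [k_even lt_k le_k kE]]].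
- apply: Sol_II_even_line => // k k_par k_range kE; apply: nIJ.
    have [le_k|lt_k] := leqP (2 * k) n; last left.
      by right; apply/JP; exists k; case/andP: k_range.
    by right; apply/ImP; exists k; case/andP: k_range.
  by left; left; apply/IpP; exists k.
- exact: Sol_II_even_odd_exponent kE.
- exact: Sol_II_even_small_exponent kE.
- exact: Sol_II_even_large_exponent kE.
Qed.

(** The chain from 0 stops at the even number n - k, the one from k at n. *)
Lemma Sol_II_odd_exponent s n k : odd n -> odd k -> (k <= n)%N ->
    (2 * k)%:R = n.+1%:R - s ->
  is_direct_sum (Sol_II s n) (a_fun s n) (b_fun s n).
Proof.
move=> n_odd k_odd le_k kE.
have NE : n%:R + s - 1 = (4 * (n - k)./2)%:R.
  have -> : s = n.+1%:R - (2 * k)%:R by rewrite kE; ring.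
  rewrite (_ : 4 * (n - k)./2 = 2 * (n - k))%N; last lia.
  by rewrite !natrM natrB //; ring.
have [||M lt_M|Sa a0] := @a_fun_Sol s n (n - k)./2; [lia|by right| |].
  by rewrite -kE => /eqP; rewrite eqr_nat; lia.
apply: (Sol_II_direct_sum _ kE Sa a0); first lia.
by apply: (@b_fun_Sol s n k (n - k)./2) => //; [lia|lia|left].
Qed.

(** A chain from 0 stops at an even number 2 i = (n + s - 1)/2, and then
    n - 2 i is an odd exponent; a chain from an even exponent k would have to
    stop at n or n - k, which have the wrong parity. *)
Lemma Sol_II_odd_eq0 s n p : odd n ->
    (forall k, odd k -> (k <= n)%N -> (2 * k)%:R <> n.+1%:R - s) ->
  Sol_II s n p -> p = 0.
Proof.
move=> n_odd s_neq Sp; apply: (Sol_II_eq0 Sp) => [|k k_gt0 kE].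
  apply/eqP/negPn/negP => p0.
  have [i [le_i end_i _]] := Sol_II_last_exponent Sp p0.
  case: end_i => [|iE]; first lia.
  apply: (s_neq (n - 2 * i)%N); [lia|lia|].
  rewrite natrM natrB; last lia.
  transitivity (2 * n%:R - (2 * (0 + 2 * i))%:R : R[i]); first by ring.
  by rewrite iE; ring.
apply/eqP/negPn/negP => pk.
have [i [le_i end_i _]] := Sol_II_last_exponent Sp pk.
have [k_odd|k_even] := boolP (odd k); first by apply: (s_neq k) => //; lia.
case: end_i => [|iE]; first lia.
have /eqP : (2 * (k + 2 * i) + 2 * k)%:R = (2 * n)%:R :> R[i].
  by rewrite natrD iE kE; ring.
rewrite eqr_nat; lia.
Qed.

Lemma Sol_II_even_neq0 s n : ~~ odd n -> exists2 p, Sol_II s n p & p != 0.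
Proof.
move=> n_even.
have neq0 p k : p`_k = 1 -> p != 0.
  by move=> pk; apply: contra_eq_neq pk => ->; rewrite coef0 eq_sym oner_neq0.
have [[k [k_even k_gt0 le_k kE]]|s_neq] :=
  pselect (exists k, [/\ ~~ odd k, (0 < k)%N, (k <= n)%N &
                         (2 * k)%:R = n.+1%:R - s]).
  have [||Sb _ bk] := @b_fun_Sol s n k (n - k)./2 k_gt0 kE; [lia|left|].
    have -> : s = n.+1%:R - (2 * k)%:R by rewrite kE; ring.
    rewrite (_ : 4 * (n - k)./2 = 2 * (n - k))%N; last lia.
    by rewrite !natrM natrB //; ring.
  by exists (b_fun s n) => //; apply: neq0 bk.
have [k k_even /andP[k_gt0 le_k] kE|Sa a0] := @Sol_II_even_generic s n n_even.
  by apply: s_neq; exists k.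
by exists (a_fun s n) => //; apply: neq0 a0.
Qed.

Lemma direct_sum_neq0 (V : set {poly R[i]}) f g :
  is_direct_sum V f g -> V <> [set 0].
Proof.
move=> [-> fg0] V0.
have : [set p | exists x y, p = x *: f + y *: g] f.
  by exists 1, 0; rewrite scale1r scale0r addr0.
rewrite V0 /= => f0; have [] := fg0 1 0.
  by rewrite f0 scaler0 scale0r addr0.
by move/eqP; rewrite oner_eq0.
Qed.

(** * The special values of s in terms of the second exponent *)

Lemma exponent_of_pos n k m :
  (m + 2 * k = n.+1)%N -> (2 * k)%:R = n.+1%:R - m%:R :> R[i].
Proof. by move=> <-; rewrite natrD; ring. Qed.

Lemma exponent_of_neg n k m :
  (2 * k = n.+1 + m)%N -> (2 * k)%:R = n.+1%:R - - m%:R :> R[i].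
Proof. by move=> ->; rewrite natrD; ring. Qed.

Lemma pos_exponent s n k m :
  (2 * k)%:R = n.+1%:R - s -> (m + 2 * k = n.+1)%N -> s = m%:R.
Proof. by move=> kE /exponent_of_pos; rewrite kE => /addrI/oppr_inj. Qed.

Lemma neg_exponent s n k m :
  (2 * k)%:R = n.+1%:R - s -> (2 * k = n.+1 + m)%N -> s = - m%:R.
Proof. by move=> kE /exponent_of_neg; rewrite kE => /addrI/oppr_inj. Qed.

Lemma I0pP s n : (n = 0 %[mod 4])%N -> I0p n s <->
  exists k, [/\ odd k, (2 * k <= n)%N & (2 * k)%:R = n.+1%:R - s].
Proof.
move=> n4; split=> [[j lt_j ->]|[k [k_odd le_k kE]]].
  exists (n./2 - 1 - 2 * j)%N.
  by split; [lia|lia|apply: exponent_of_pos; lia].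
by exists ((n - 2 - 2 * k) %/ 4)%N; [lia|apply: (pos_exponent kE); lia].
Qed.

Lemma I0mP s n : (n = 0 %[mod 4])%N -> I0m n s <->
  exists k, [/\ ~~ odd k, (n < 2 * k)%N, (k <= n)%N &
                (2 * k)%:R = n.+1%:R - s].
Proof.
move=> n4; split=> [[j lt_j ->]|[k [k_even lt_k le_k kE]]].
  exists (n./2 + 2 + 2 * j)%N.
  by split; [lia|lia|lia|apply: exponent_of_neg; lia].
by exists ((2 * k - n - 4) %/ 4)%N; [lia|apply: (neg_exponent kE); lia].
Qed.

Lemma J0P s n : (n = 0 %[mod 4])%N -> J0 n s <->
  exists k, [/\ ~~ odd k, (0 < k)%N, (2 * k <= n)%N & (2 * k)%:R = n.+1%:R - s].
Proof.
move=> n4; split=> [[j lt_j ->]|[k [k_even k_gt0 le_k kE]]].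
  exists (n./2 - 2 * j)%N.
  by split; [lia|lia|lia|apply: exponent_of_pos; lia].
by exists ((n - 2 * k) %/ 4)%N; [lia|apply: (pos_exponent kE); lia].
Qed.

Lemma I2pP s n : (n = 2 %[mod 4])%N -> I2p n s <->
  exists k, [/\ odd k, (2 * k <= n)%N & (2 * k)%:R = n.+1%:R - s].
Proof.
move=> n4; split=> [[j lt_j ->]|[k [k_odd le_k kE]]].
  exists (n./2 - 2 * j)%N.
  by split; [lia|lia|apply: exponent_of_pos; lia].
by exists ((n - 2 * k) %/ 4)%N; [lia|apply: (pos_exponent kE); lia].
Qed.

Lemma I2mP s n : (n = 2 %[mod 4])%N -> I2m n s <->
  exists k, [/\ ~~ odd k, (n < 2 * k)%N, (k <= n)%N &
                (2 * k)%:R = n.+1%:R - s].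
Proof.
move=> n4; split=> [[j lt_j ->]|[k [k_even lt_k le_k kE]]].
  exists (n./2 + 1 + 2 * j)%N.
  by split; [lia|lia|lia|apply: exponent_of_neg; lia].
by exists ((2 * k - n - 2) %/ 4)%N; [lia|apply: (neg_exponent kE); lia].
Qed.

Lemma J2P s n : (n = 2 %[mod 4])%N -> J2 n s <->
  exists k, [/\ ~~ odd k, (0 < k)%N, (2 * k <= n)%N & (2 * k)%:R = n.+1%:R - s].
Proof.
move=> n4; split=> [[j lt_j ->]|[k [k_even k_gt0 le_k kE]]].
  exists (n./2 - 1 - 2 * j)%N.
  by split; [lia|lia|lia|apply: exponent_of_pos; lia].
by exists ((n - 2 - 2 * k) %/ 4)%N; [lia|apply: (pos_exponent kE); lia].
Qed.

Lemma I1P s n : (n = 1 %[mod 4])%N -> I1 n s <->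
  exists k, [/\ odd k, (k <= n)%N & (2 * k)%:R = n.+1%:R - s].
Proof.
move=> n4; split=> [[j le_j [->|->]]|[k [k_odd le_k kE]]].
- exists ((n.+1 - 4 * j) %/ 2)%N.
  by split; [lia|lia|apply: exponent_of_pos; lia].
- exists ((n.+1 + 4 * j) %/ 2)%N.
  by split; [lia|lia|apply: exponent_of_neg; lia].
have [le2k|lt2k] := leqP (2 * k) n.+1.
  by exists ((n.+1 - 2 * k) %/ 4)%N; [lia|left; apply: (pos_exponent kE); lia].
by exists ((2 * k - n.+1) %/ 4)%N; [lia|right; apply: (neg_exponent kE); lia].
Qed.

Lemma I3P s n : (n = 3 %[mod 4])%N -> I3 n s <->
  exists k, [/\ odd k, (k <= n)%N & (2 * k)%:R = n.+1%:R - s].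
Proof.
move=> n4; split=> [[j le_j [->|->]]|[k [k_odd le_k kE]]].
- exists ((n - 1 - 4 * j) %/ 2)%N.
  by split; [lia|lia|apply: exponent_of_pos; lia].
- exists ((n + 3 + 4 * j) %/ 2)%N.
  by split; [lia|lia|apply: exponent_of_neg; lia].
have [le2k|lt2k] := leqP (2 * k) n.+1.
  by exists ((n.+1 - 2 * k) %/ 4)%N; [lia|left; apply: (pos_exponent kE); lia].
by exists ((2 * k - n.+1) %/ 4)%N; [lia|right; apply: (neg_exponent kE); lia].
Qed.

End Solutions.

Theorem theorem5p16 (R : realType) (s : R[i]) (n : nat) :
  (Sol_II s n <> [set 0] <->
     [\/ (n = 0 %[mod 4])%N,
         (n = 1 %[mod 4])%N /\ I1 n s,
         (n = 2 %[mod 4])%N |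
         (n = 3 %[mod 4])%N /\ I3 n s])
  /\
  [/\ (n = 0 %[mod 4])%N ->
        [/\ (~ (I0p n `|` I0m n `|` J0 n) s ->
               Sol_II s n = line (a_fun s n)),
            (I0p n s -> is_direct_sum (Sol_II s n) (a_fun s n) (b_fun s n)),
            (J0 n s -> Sol_II s n = line (b_fun s n)) &
            (I0m n s ->
               is_direct_sum (Sol_II s n) (c_plus s n) (c_minus s n))],
      (n = 1 %[mod 4])%N -> I1 n s ->
        is_direct_sum (Sol_II s n) (a_fun s n) (b_fun s n),
      (n = 2 %[mod 4])%N ->
        [/\ (~ (I2p n `|` I2m n `|` J2 n) s ->
               Sol_II s n = line (a_fun s n)),
            (I2p n s -> is_direct_sum (Sol_II s n) (a_fun s n) (b_fun s n)),
            (J2 n s -> Sol_II s n = line (b_fun s n)) &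
            (I2m n s ->
               is_direct_sum (Sol_II s n) (c_plus s n) (c_minus s n))] &
      (n = 3 %[mod 4])%N -> I3 n s ->
        is_direct_sum (Sol_II s n) (a_fun s n) (b_fun s n)].
Proof.
split; last first.
  split=> [n4|n4 /(I1P _ n4)[k [k_odd le_k kE]]|
           n4|n4 /(I3P _ n4)[k [k_odd le_k kE]]].
  - apply: Sol_II_even_cases; [lia|exact: I0pP|exact: I0mP|exact: J0P].
  - by apply: Sol_II_odd_exponent kE => //; lia.
  - apply: Sol_II_even_cases; [lia|exact: I2pP|exact: I2mP|exact: J2P].
  - by apply: Sol_II_odd_exponent kE => //; lia.
have even_neq0 : ~~ odd n -> Sol_II s n <> [set 0].
  move=> /(Sol_II_even_neq0 s)[p Sp p0] S0; move: Sp p0.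
  by rewrite S0 /= => ->; rewrite eqxx.
split=> [S_neq0|[n4|[n4 /(I1P _ n4)[k [k_odd le_k kE]]]|n4|
                 [n4 /(I3P _ n4)[k [k_odd le_k kE]]]]].
- have [n_odd|n_even] := boolP (odd n); last first.
    have [n4|n4] : (n = 0 %[mod 4])%N \/ (n = 2 %[mod 4])%N by lia.
      by constructor 1.
    by constructor 3.
  have [[k [k_odd le_k kE]]|s_neq] :=
      pselect (exists k, [/\ odd k, (k <= n)%N & (2 * k)%:R = n.+1%:R - s]).
    have [n4|n4] : (n = 1 %[mod 4])%N \/ (n = 3 %[mod 4])%N by lia.
      by constructor 2; split=> //; apply/I1P => //; exists k.
    by constructor 4; split=> //; apply/I3P => //; exists k.
  case: S_neq0; apply/seteqP; split=> p /= => [|->]; last exact: Sol_II0.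
  by apply: Sol_II_odd_eq0 => // k k_odd le_k kE; apply: s_neq; exists k.
- by apply: even_neq0; lia.
- by apply: direct_sum_neq0 (Sol_II_odd_exponent _ k_odd le_k kE); lia.
- by apply: even_neq0; lia.
- by apply: direct_sum_neq0 (Sol_II_odd_exponent _ k_odd le_k kE); lia.
Qed.
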